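(* Let $\zeta_1,\zeta_2,\dots$ be i.i.d. real random variables with zero mean such that $$\Lambda(\lambda):=\log\mathbf E\big(e^{\lambda\zeta_i}\big)<\infty\qquad\text{for all }\lambda\in\mathbb R.$$ Let $G:\mathbb R\to\mathbb R_+$ be a smooth function for which there is a finite constant $C_1$ with $$G(x)\le C_1\big(|x|\wedge(x^2/2)\big)\qquad\text{for all }x\in\mathbb R.$$ Then there exist constants $\gamma_0>0$ and $C<\infty$ such that for any $0<\gamma<\gamma_0$ and any integer $l\ge1/\gamma_0$, $$\mathbf E\exp\big\{\gamma l\,G\big((\zeta_1+\dots+\zeta_l)/l\big)\big\}<C .$$
   Context: $\mathbb R_+=[0,\infty)$ and $a\wedge b=\min\{a,b\}$. *)

(* Defs.v *)
From mathcomp Require Export all_boot all_order all_algebra finmap.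
From mathcomp Require Export all_classical all_reals all_analysis.
Export Order.TTheory GRing.Theory Num.Theory.
Export numFieldNormedType.Exports.

Set Implicit Arguments.
Unset Strict Implicit.
Unset Printing Implicit Defensive.

Local Open Scope classical_set_scope.
Local Open Scope ring_scope.

Definition mutually_independent (d : measure_display) (T : measurableType d)
    (R : realType) (P : probability T R) (X : nat -> {RV P >-> R}) : Prop :=
  forall (J : {fset nat}) (A : nat -> set R),
    (forall i, i \in J -> measurable (A i)) ->
    P (\bigcap_(i in [set` J]) (X i @^-1` A i)) =
    (\prod_(i <- J) P (X i @^-1` A i))%E.
Arguments mutually_independent {d T R} P X.

(* Laws are compared on measurable sets only: the value of [distribution] on
   a non-measurable set carries no information. *)
Definition identically_distributed (d : measure_display) (T : measurableType d)
    (R : realType) (P : probability T R) (X : nat -> {RV P >-> R}) : Prop :=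
  forall (i j : nat) (A : set R), measurable A ->
    distribution P (X i) A = distribution P (X j) A.
Arguments identically_distributed {d T R} P X.

Definition iid (d : measure_display) (T : measurableType d)
    (R : realType) (P : probability T R) (X : nat -> {RV P >-> R}) : Prop :=
  mutually_independent P X /\ identically_distributed P X.
Arguments iid {d T R} P X.

Definition log_mgf (d : measure_display) (T : measurableType d)
    (R : realType) (P : probability T R) (X : {RV P >-> R}) (t : R) : \bar R :=
  lne ('M_P X t).
Arguments log_mgf {d T R} P X t.

Definition smooth (R : realType) (f : R -> R) : Prop :=
  forall (n : nat) (x : R), derivable (derive1n n f) x 1.

(* Main.v *)
Require Import Defs.
From mathcomp Require Import measurable_realfun ring lra.

(**
Put [S = zeta_1 + ... + zeta_l], [x = S / l] and [a = min(|x|, x^2/2)].  Since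
[zeta] is centred with finite exponential moments, [E exp (t zeta)] is at most
[exp (K t^2)] for [|t| <= 1], so by independence each [exp (t S - l K t^2)] has
expectation at most 1.  If [s <= a], the tilt [t = min(1, sqrt s) / (2K)] gives
[t |x| - K t^2 >= s / (4K)].  Summing over the levels [s = n / l] with weights of
order [exp (- n / (8K))], the function [exp (l a / (8K))] is dominated pointwise
by a series whose expectation is at most a geometric series independent of [l].
*)

Local Open Scope classical_set_scope.
Local Open Scope ring_scope.

(** * Expectation of a product of functions of independent variables *)

Section indep.
Context {R : realType} {d} {T : measurableType d} (P : probability T R).
Import HBNNSimple.

Section factor.
Variables (H : T -> R) (X : {RV P >-> R}).
Hypotheses (mH : measurable_fun setT H) (H0 : forall w, 0 <= H w).
Hypothesis Hfin : (\int[P]_w (H w)%:E < +oo)%E.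
(** Independence of [X] from the weight [H], required only against indicators of [X]. *)
Hypothesis HX : forall A : set R, measurable A ->
  (\int[P]_w (H w * \1_A (X w))%:E = \int[P]_w (H w)%:E * P (X @^-1` A))%E.

(** Splitting [h] over its finitely many values reduces the claim to [HX] on each level set. *)
Lemma integral_mul_nnsfun (h : {nnsfun R >-> R}) :
  (\int[P]_w (H w * h (X w))%:E =
   \int[P]_w (H w)%:E * \int[P]_w (h (X w))%:E)%E.
Proof.
have mX r : measurable_fun setT (fun w => (\1_(h @^-1` [set r]) (X w) : R)).
  by apply: measurableT_comp.
have hE w : (h (X w))%:E =
    (\sum_(r \in range h) (r * \1_(h @^-1` [set r]) (X w))%:E)%E.
  by rewrite [in LHS]fimfunE -fsumEFin.
have r0 r w : (0 <= (r * \1_(h @^-1` [set r]) (X w))%:E)%E.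
  by rewrite EFinM nnfun_muleindic_ge0.
have mr r :
    measurable_fun setT (fun w => (r * \1_(h @^-1` [set r]) (X w))%:E).
  by apply/measurable_EFinP/measurable_funM.
under [X in _ = (_ * X)%E]eq_integral do rewrite hE.
rewrite ge0_integral_fsum//.
rewrite ge0_mule_fsumr => [|r]; last by apply: integral_ge0.
under eq_integral do rewrite EFinM hE ge0_mule_fsumr//.
rewrite ge0_integral_fsum//; last 2 first.
- by move=> r; apply: emeasurable_funM => //; exact/measurable_EFinP.
- by move=> r w _; rewrite mule_ge0// lee_fin.
apply: eq_fsbigr => r /[!inE] -[w _ hwr].
have rge0 : 0 <= r by rewrite -hwr.
under eq_integral do rewrite -EFinM mulrCA EFinM.
rewrite ge0_integralZl_EFin//; last 2 first.
- by move=> x _; rewrite lee_fin mulr_ge0.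
- by apply/measurable_EFinP/measurable_funM.
rewrite HX//.
under [in RHS]eq_integral do rewrite EFinM.
rewrite ge0_integralZl_EFin//; last exact/measurable_EFinP.
rewrite [LHS]muleCA; congr (_ * (_ * _))%E.
rewrite -[X in P X]setIT -integral_indic//.
by rewrite -[X in measurable X]setTI; exact: measurable_funP.
Qed.

(** Simple functions increase to [g], and monotone convergence applies on both sides; [Hfin] lets
    the constant factor pass through the limit. *)
Lemma integral_mul_comp (g : R -> R) : measurable_fun setT g ->
    (forall x, 0 <= g x) ->
  (\int[P]_w (H w * g (X w))%:E =
   \int[P]_w (H w)%:E * \int[P]_w (g (X w))%:E)%E.
Proof.
move=> mg g0.
have mEg : measurable_fun setT (EFin \o g) by exact/measurable_EFinP.
pose g_ := nnsfun_approx measurableT mEg.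
have cvg_g x : (g_ n x)%:E @[n --> \oo] --> (g x)%:E.
  by apply: (cvg_nnsfun_approx measurableT mEg) => // y _; rewrite lee_fin.
have nd_g x m n : (m <= n)%N -> g_ m x <= g_ n x.
  by move=> mn; exact/lefP/nd_nnsfun_approx.
have mgX n : measurable_fun setT (fun w => g_ n (X w)).
  by apply: measurableT_comp.
have -> : (\int[P]_w (H w * g (X w))%:E =
    limn (fun n => \int[P]_w (H w * g_ n (X w))%:E))%E.
  rewrite -monotone_convergence//.
  - apply: eq_integral => w _; apply/esym/cvg_lim => //.
    rewrite EFinM; under eq_fun do rewrite EFinM.
    exact: cvgeZl.
  - by move=> n; apply/measurable_EFinP/measurable_funM.
  - by move=> n w _; rewrite lee_fin mulr_ge0.
  - by move=> w _ m n mn; rewrite lee_fin ler_wpM2l// nd_g.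
have -> : (\int[P]_w (g (X w))%:E = limn (fun n => \int[P]_w (g_ n (X w))%:E))%E.
  rewrite -monotone_convergence//.
  - by apply: eq_integral => w _; exact/esym/cvg_lim.
  - by move=> n; exact/measurable_EFinP.
  - by move=> n w _; rewrite lee_fin.
  - by move=> w _ m n mn; rewrite lee_fin nd_g.
rewrite -limeMl; last 2 first.
- by rewrite ge0_fin_numE// integral_ge0// => w _; rewrite lee_fin.
- apply/ereal_nondecreasing_is_cvgn => m n mn; apply: ge0_le_integral => //.
  + by move=> w _; rewrite lee_fin.
  + exact/measurable_EFinP.
  + exact/measurable_EFinP.
  + by move=> w _; rewrite lee_fin nd_g.
by congr (limn _); apply/funext => n; rewrite integral_mul_nnsfun.
Qed.

End factor.

Variable X : nat -> {RV P >-> R}.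
Hypothesis indepX : mutually_independent P X.

Lemma expectation_prod_indep (J : {fset nat}) (F : nat -> R -> R) :
    (forall i, measurable_fun setT (F i)) -> (forall i x, 0 <= F i x) ->
    (forall i, 'E_P[F i \o X i] < +oo)%E ->
  ('E_P[fun w => (\prod_(i <- J) F i (X i w))%R] =
   \prod_(i <- J) 'E_P[F i \o X i])%E.
Proof.
pose indicator i (G : nat -> R -> R) :=
  exists2 A : set R, measurable A & G i = \1_A.
(* Induction on [n]: only the factors of index below [n] are not indicators. *)
suff Q n : forall G : nat -> R -> R,
    (forall i, measurable_fun setT (G i)) -> (forall i x, 0 <= G i x) ->
    (forall i, 'E_P[G i \o X i] < +oo)%E ->
    (forall i, i \in J -> (n <= i)%N -> indicator i G) ->
  ('E_P[fun w => (\prod_(i <- J) G i (X i w))%R] =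
   \prod_(i <- J) 'E_P[G i \o X i])%E.
  (* Beyond the largest index of [J] the indicator condition is vacuous. *)
  move=> mF F0 Ffin; apply: (Q (\max_(i <- J) i).+1) => // i iJ.
  by rewrite ltnNge leq_bigmax_seq.
elim: n => [|n IHn] G mG G0 Gfin Gind.
  have [A AP] : exists A : nat -> set R, forall i, i \in J ->
      measurable (A i) /\ G i = \1_(A i).
    suff /choice[A AP] : forall i, exists B,
        i \in J -> measurable B /\ G i = \1_B.
      by exists A.
    move=> i; have [iJ|_] := boolP (i \in J); last by exists set0.
    by have [B mB GB] := Gind i iJ (leq0n _); exists B.
  transitivity (P (\bigcap_(i in [set` J]) (X i @^-1` A i))).
    rewrite -expectation_indic; last first.
      apply: fin_bigcap_measurable => // i /= iJ.
      rewrite -[X in measurable X]setTI; apply: measurable_funP => //.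
      by have [] := AP i iJ.
    congr expectation; apply/funext => w.
    rewrite big_seq indicE; under eq_bigr => i iJ do rewrite (AP i iJ).2 indicE.
    rewrite -big_seq; have [wA|wA] := boolP (w \in _).
      rewrite big_seq big1// => i iJ; rewrite mem_set//.
      by move: wA; rewrite inE => /(_ i iJ).
    have [i iJ Ai] : exists2 i, i \in J & ~ A i (X i w).
      apply: contrapT => nA; move/negP: wA; apply; rewrite inE => i iJ.
      by apply: contrapT => Ai; apply: nA; exists i.
    by rewrite (big_fsetD1 i)//= memNset// mul0r.
  rewrite indepX => [|i /AP[]//].
  rewrite big_seq [RHS]big_seq; apply: eq_bigr => i iJ.
  have [mA ->] := AP i iJ.
  rewrite -expectation_indic//.
  by rewrite -[X in measurable X]setTI; exact: measurable_funP.
have [nJ|nJ] := boolP (n \in J); last first.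
  apply: IHn => // i iJ; rewrite leq_eqVlt => /predU1P[ni|]; last exact: Gind.
  by rewrite ni iJ in nJ.
(* With an indicator in place of factor [n] the induction hypothesis applies; this yields the
   hypothesis [HX] of [integral_mul_comp]. *)
pose upd g i := if i == n then g else G i.
have updN g i : i != n -> upd g i = G i by rewrite /upd => /negPf ->.
have updn g : upd g n = g by rewrite /upd eqxx.
pose H w := \prod_(i <- (J `\ n)%fset) G i (X i w).
have HE g w : \prod_(i <- J) upd g i (X i w) = H w * g (X n w).
  rewrite (big_fsetD1 n)//= updn mulrC; congr (_ * _).
  by apply: eq_big_seq => i; rewrite !inE => /andP[? _]; rewrite updN.
have upd_ind A : measurable A -> ('E_P[fun w => (H w * \1_A (X n w))%R] =
    \prod_(i <- (J `\ n)%fset) 'E_P[G i \o X i] * P (X n @^-1` A))%E.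
  move=> mA; transitivity ('E_P[fun w => (\prod_(i <- J) upd \1_A i (X i w))%R])%E.
    by congr expectation; apply/funext => w; rewrite HE.
  have EA : ('E_P[\1_A \o X n] = P (X n @^-1` A))%E.
    rewrite -expectation_indic//.
    by rewrite -[X in measurable X]setTI; exact: measurable_funP.
  rewrite IHn; first last.
  - move=> i iJ; rewrite leq_eqVlt => /predU1P[<-|ni].
      by exists A; rewrite ?updn.
    by rewrite /indicator updN; [exact: Gind|rewrite gtn_eqF].
  - move=> i; have [->|ni] := eqVneq i n; last by rewrite updN.
    by rewrite updn EA (le_lt_trans (probability_le1 _ _)) ?ltry//
      -[X in measurable X]setTI; exact: measurable_funP.
  - by move=> i x; rewrite /upd; case: ifP.
  - by move=> i; rewrite /upd; case: ifP.
  rewrite (big_fsetD1 n)//= updn EA muleC; congr (_ * _)%E.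
  by apply: eq_big_seq => i; rewrite !inE => /andP[? _]; rewrite updN.
(* Taking the whole line for [A] removes factor [n]. *)
have EH : ('E_P[H] = \prod_(i <- (J `\ n)%fset) 'E_P[G i \o X i])%E.
  have := upd_ind _ measurableT; rewrite preimage_setT probability_setT mule1.
  by move=> <-; congr expectation; apply/funext => w; rewrite indicT/= mulr1.
have GE0 i : (0 <= 'E_P[G i \o X i])%E by apply: expectation_ge0 => w; exact: G0.
have Hfin : ('E_P[H] < +oo)%E.
  rewrite EH -ge0_fin_numE; last exact: prode_ge0.
  by apply: prode_fin_num => i _; rewrite ge0_fin_numE.
transitivity ('E_P[fun w => (H w * G n (X n w))%R])%E.
  congr expectation; apply/funext => w; rewrite -(HE (G n)).
  by apply: eq_bigr => i _; rewrite /upd; case: eqP => // ->.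
rewrite (big_fsetD1 n)//= muleC -EH unlock; apply: integral_mul_comp => //.
- by apply: measurable_prod => i _; exact: measurableT_comp.
- by move=> w; exact: prodr_ge0.
- by move: Hfin; rewrite unlock.
- by move=> A mA; move: (upd_ind A mA) EH; rewrite unlock => -> ->.
Qed.

End indep.

(** * Elementary inequalities for the exponential and the tilt *)

Section real_inequalities.
Context {R : realType}.
Implicit Types u z t x s K : R.

(** The bound [1 + v <= expR v] is used at [v = - u], giving [expR u - 1 <= u * expR u], and at
    [v = u] when [u] is negative. *)
Lemma expR_quadratic_bound u : expR u <= 1 + u + u ^+ 2 * expR `|u|.
Proof.
have uE : expR u - 1 <= u * expR u.
  have := ler_wpM2r (expR_ge0 u) (expR_ge1Dx (- u)).
  by rewrite -expRD addNr expR0; lra.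
have u2E : expR u - 1 - u <= u * (expR u - 1) by lra.
suff : u * (expR u - 1) <= u ^+ 2 * expR `|u| by lra.
have [u0|u0] := leP 0 u.
  by rewrite expr2 -mulrA ler_wpM2l// ger0_norm.
have u1 : u * (expR u - 1) <= u ^+ 2.
  by rewrite expr2 (ler_wnM2l (ltW u0))//; have := expR_ge1Dx u; lra.
rewrite (le_trans u1)// ler_peMr ?sqr_ge0//.
by rewrite -expR0 ler_expR.
Qed.

(** The square costs one more exponential of [|z|], up to the factor 4, and [exp (2 |z|)] is one of
    the two terms on the right. *)
Lemma sqr_expR_bound z :
  z ^+ 2 * expR `|z| <= 4 * (expR (2 * z) + expR (- 2 * z)).
Proof.
have half : z ^+ 2 <= 4 * expR `|z|.
  have := expR_ge1Dx (`|z| / 2); set e := expR _ => e1.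
  have <- : e ^+ 2 = expR `|z| by rewrite -expRM_natl; congr expR; lra.
  have := normr_ge0 z; rewrite -[z ^+ 2]real_normK ?num_real//; nra.
have e2 : expR `|z| * expR `|z| <= expR (2 * z) + expR (- 2 * z).
  rewrite -expRD; case: (ger0P z) => z0.
    by rewrite (_ : z + z = 2 * z) ?lerDl ?expR_ge0//; ring.
  by rewrite (_ : - z - z = - 2 * z) ?lerDr ?expR_ge0//; ring.
have := expR_ge0 `|z|; nra.
Qed.

(** The remainder is [t ^+ 2] times a quantity free of [t], so one moment bound serves all tilts. *)
Lemma expR_tilt_bound t z : `|t| <= 1 ->
  expR (t * z) <= 1 + t * z + t ^+ 2 * (4 * (expR (2 * z) + expR (- 2 * z))).
Proof.
move=> t1; apply: le_trans (expR_quadratic_bound _) _.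
rewrite lerD2l exprMn -mulrA ler_wpM2l ?sqr_ge0//.
apply: le_trans (sqr_expR_bound z); rewrite ler_wpM2l ?sqr_ge0//.
by rewrite ler_expR normrM ler_piMl.
Qed.

(** The exponent [t |x| - K t^2] is maximal at [t = |x| / (2 K)]. Here [|x|] is replaced by its
    lower bound [sqrt s], cut at 1 to keep the tilt in the range of the moment bound. *)
Definition tilt K s := Num.min 1 (Num.sqrt s) / (2 * K).

Lemma tilt_norm_le1 K s : 1 <= K -> `|tilt K s| <= 1.
Proof.
move=> K1; have K0 : 0 < 2 * K by lra.
have m0 : 0 <= Num.min 1 (Num.sqrt s) by rewrite le_min ler01 sqrtr_ge0.
have m1 : Num.min 1 (Num.sqrt s) <= 1 by rewrite ge_min lexx.
by rewrite ger0_norm ?(divr_ge0 m0 (ltW K0))// ler_pdivrMr//; lra.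
Qed.

Lemma tilt_gain K s x : 1 <= K -> 0 <= s -> s <= `|x| -> s <= x ^+ 2 / 2 ->
  s / (4 * K) <= tilt K s * `|x| - K * tilt K s ^+ 2.
Proof.
move=> K1 s0; rewrite -[x ^+ 2]real_normK ?num_real//.
move: `|x| (normr_ge0 x) => {}x x0 sx sx2.
rewrite /tilt; set m := Num.min 1 _.
have -> : m / (2 * K) * x - K * (m / (2 * K)) ^+ 2 =
    (2 * m * x - m ^+ 2) / (4 * K) by field; lra.
rewrite ler_wpM2r ?invr_ge0//; first by lra.
(* It remains to see [s <= 2 m x - m^2]. If [m = 1], then [x >= s >= 1]; if [m = sqrt s], then
   [x >= m] and the right side is at least [m^2 = s]. *)
rewrite /m minEle; case: ifPn => h.
  have : 1 <= s by rewrite -(ler_sqrt 1 s0) sqrtr1.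
  lra.
have := sqr_sqrtr s0; have := sqrtr_ge0 s; set r := Num.sqrt s => r0 rs.
have : r <= x by rewrite -(@ler_pXn2r _ 2)// ?nnegrE// rs; nra.
nra.
Qed.

End real_inequalities.

(** * Moment generating functions of centred variables and independent sums *)

Section mgf.
Context {R : realType} {d} {T : measurableType d} (P : probability T R).

Lemma mgfE (X : T -> R) t : ('M_P X t = 'E_P[fun w => expR (t * X w)])%E.
Proof. by congr expectation; apply/funext => w /=; rewrite mulrC. Qed.

Lemma log_mgf_lty (X : {RV P >-> R}) t : (log_mgf P X t < +oo)%E ->
  ('E_P[fun w => expR (t * X w)] < +oo)%E.
Proof. by rewrite -mgfE /log_mgf; case: ('M_P X t)%E => // r _; exact: ltry. Qed.

Lemma measurable_expRZ (X : {RV P >-> R}) t :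
  measurable_fun setT (fun w => expR (t * X w)).
Proof. by apply: measurableT_comp => //; exact: measurable_funM. Qed.

(** Both expectations are integrals against the common law. *)
Lemma expectation_expRZ_eq (X : nat -> {RV P >-> R}) i j t :
  identically_distributed P X ->
  ('E_P[fun w => expR (t * X i w)] = 'E_P[fun w => expR (t * X j w)])%E.
Proof.
move=> idX; pose f (x : R) := (expR (t * x))%:E.
have mf : measurable_fun setT f.
  by apply/measurable_EFinP/measurableT_comp => //; exact: measurable_funM.
have f0 x : (0 <= f x)%E by rewrite lee_fin expR_ge0.
have E k : ('E_P[fun w => expR (t * X k w)] = \int[distribution P (X k)]_x f x)%E.
  by rewrite unlock ge0_integral_distribution.
by rewrite !E; apply: eq_measure_integral => A mA _; exact: idX.
Qed.

(** When [expR_tilt_bound] is integrated the linear term vanishes, leaving [1 + 4 M t^2], which is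
    at most its exponential form. *)
Lemma mgf_le_gauss (X : {RV P >-> R}) (M t : R) :
  ('E_P[X] = 0)%E ->
  ('E_P[fun w => expR (2 * X w)] + 'E_P[fun w => expR (- 2 * X w)] <= M%:E)%E ->
  `|t| <= 1 ->
  ('E_P[fun w => expR (t * X w)] <= (expR (4 * M * t ^+ 2))%:E)%E.
Proof.
move=> X0 XM t1.
pose W w := expR (2 * X w) + expR (- 2 * X w).
have W0 w : 0 <= W w by rewrite addr_ge0 ?expR_ge0.
have mW : measurable_fun setT W by apply: measurable_funD; exact: measurable_expRZ.
have EW : ('E_P[W] <= M%:E)%E.
  apply: le_trans XM; rewrite unlock -ge0_integralD//;
    exact/measurable_EFinP/measurable_expRZ.
have WL : W \in Lfun P 1.
  apply/Lfun1_integrable/integrableP; split; first exact/measurable_EFinP.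
  under eq_integral do rewrite gee0_abs ?lee_fin//.
  by move: EW; rewrite unlock => /le_lt_trans; apply; rewrite ltry.
(* Integrability of [X], needed to split the expectation, comes from [|X| <= W]. *)
have XL : (X : T -> R) \in Lfun P 1.
  apply/Lfun1_integrable.
  apply: (le_integrable measurableT _ _ ((Lfun1_integrable _ _).1 WL)).
    exact/measurable_EFinP.
  move=> w _; rewrite !abse_EFin lee_fin (ger0_norm (W0 w)) /W.
  have [x0|x0] := ger0P (X w).
    by have := expR_ge1Dx (2 * X w); have := expR_ge0 (- 2 * X w); lra.
  by have := expR_ge1Dx (- 2 * X w); have := expR_ge0 (2 * X w); lra.
pose Z := (cst 1 \+ t \o* X) \+ (4 * t ^+ 2) \o* W.
have EZ : ('E_P[Z] = 1 + (4 * t ^+ 2)%:E * 'E_P[W])%E.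
  rewrite expectationD ?Lfun_scale//; last by rewrite rpredD ?Lfun_scale// Lfun_cst.
  rewrite expectationD ?Lfun_scale ?Lfun_cst//.
  by rewrite !expectationZl// X0 mule0 adde0 expectation_cst.
have le_Z w : expR (t * X w) <= Z w.
  apply: le_trans (expR_tilt_bound _ (X w) t1) _.
  by rewrite /Z /= /W; lra.
apply: (@le_trans _ _ ('E_P[Z])%E).
  rewrite unlock; apply: ge0_le_integral => //.
  - exact/measurable_EFinP/measurable_expRZ.
  - apply/measurable_EFinP; apply: measurable_funD; last exact: measurable_funM.
    by apply: measurable_funD => //; exact: measurable_funM.
  - by move=> w _; rewrite lee_fin.
rewrite EZ; apply: (@le_trans _ _ (1 + 4 * M * t ^+ 2)%:E); last first.
  by rewrite lee_fin expR_ge1Dx.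
rewrite [in leRHS]EFinD leeD2l// [4 * M * _]mulrAC [leRHS]EFinM.
by rewrite lee_wpmul2l// lee_fin mulr_ge0 ?sqr_ge0.
Qed.

(** Independence splits the expectation, and the subtracted term cancels the product of the [l]
    individual bounds. *)
Lemma mgf_sum_le_gauss (X : nat -> {RV P >-> R}) (l : nat) (K t : R) :
  mutually_independent P X ->
  (forall i, ('E_P[fun w => expR (t * X i w)] <= (expR (K * t ^+ 2))%:E)%E) ->
  ('E_P[fun w => expR (t * (\sum_(i < l) X i w) - l%:R * K * t ^+ 2)%R] <= 1)%E.
Proof.
(* Independence is stated over finite sets of indices, hence the passage from ordinals to [J]. *)
move=> indX XK; pose J := [fset i in iota 0 l]%fset.
have bigJ (V : Type) (idx : V) (op : Monoid.com_law idx) (F : nat -> V) :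
    \big[op/idx]_(i <- J) F i = \big[op/idx]_(i < l) F i.
  rewrite -(big_mkord xpredT) /index_iota subn0; apply: perm_big.
  by apply: uniq_perm => [||i]; rewrite ?fset_uniq ?iota_uniq// inE.
have XJ w : expR (t * (\sum_(i < l) X i w) - l%:R * K * t ^+ 2) =
    expR (- (l%:R * K * t ^+ 2)) * \prod_(i <- J) expR (t * X i w).
  rewrite (bigJ _ _ *%R (fun i => expR (t * X i w))).
  by rewrite -expR_sum -expRD mulr_sumr addrC.
under [X in expectation _ X]eq_fun do rewrite XJ.
have mp : measurable_fun setT (fun w => \prod_(i <- J) expR (t * X i w)).
  by apply: measurable_prod => i _; exact: measurable_expRZ.
have -> : ('E_P[fun w => (expR (- (l%:R * K * t ^+ 2)) *
      \prod_(i <- J) expR (t * X i w))%R] =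
    (expR (- (l%:R * K * t ^+ 2)))%:E *
    'E_P[fun w => (\prod_(i <- J) expR (t * X i w))%R])%E.
  rewrite unlock -ge0_integralZl_EFin ?expR_ge0//.
  - by move=> w _; rewrite lee_fin prodr_ge0// => i _; exact: expR_ge0.
  - exact/measurable_EFinP.
rewrite (expectation_prod_indep _ _ indX _ (fun _ x => expR (t * x))); first last.
- by move=> i; rewrite (le_lt_trans (XK i))// ltry.
- by move=> i x; exact: expR_ge0.
- by move=> i; apply: measurableT_comp => //; exact: measurable_funM.
rewrite (bigJ _ _ (@mule R) (fun i => 'E_P[(fun x => expR (t * x)) \o X i])%E).
rewrite muleC expRN lee_pdivrMr ?expR_gt0// mul1e.
have -> : expR (l%:R * K * t ^+ 2) = \prod_(i < l) expR (K * t ^+ 2).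
  by rewrite -expR_sum sumr_const card_ord -mulrA mulr_natl.
rewrite -prodEFin.
(* Multiplying inequalities needs nonnegative factors, so positivity is carried through the
   induction. *)
suff /andP[] : (0 <= \prod_(i < l) 'E_P[(fun x => expR (t * x)) \o X i] <=
  \prod_(i < l) (expR (K * t ^+ 2))%:E)%E by [].
elim/big_ind2 : _ => [|a b c e /andP[b0 ba] /andP[e0 ec]|i _].
- by rewrite lee01 lexx.
- by rewrite mule_ge0//= lee_pmul.
- by rewrite XK andbT; apply: expectation_ge0 => w; exact: expR_ge0.
Qed.

End mgf.

(** * Exponential moment bound by a mixture over tilts *)

Section cramer.
Context {R : realType}.

(** Both signs of the tilt appear, so that one of them matches the sign of [S]. *)
Definition tilted_exp (K l S s : R) : R :=
  expR (tilt K s * S - l * K * tilt K s ^+ 2) +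
  expR (- tilt K s * S - l * K * (- tilt K s) ^+ 2).

(** Level [s = n / l] has weight [exp (c - c n)] with [c = 1 / (8 K)]. The gain there is
    [exp (2 c n)]: half of it survives the weight, and [exp c] pays for rounding down to an integer
    level. *)
Definition mixture_term (K : R) (l : nat) (n : nat) (S : R) : R :=
  expR (8 * K)^-1 * expR (- (8 * K)^-1) ^+ n *
  tilted_exp K l%:R S (n%:R / l%:R).

Lemma mixture_term_ge0 K l n S : 0 <= mixture_term K l n S.
Proof. by rewrite !mulr_ge0 ?exprn_ge0 ?addr_ge0 ?expR_ge0. Qed.

(** With [n] the integer part of [l a], the level [n / l] is at most [a], so [tilt_gain] applies to
    it. *)
Lemma expR_le_mixture_term (K S a : R) (l : nat) : 1 <= K -> (0 < l)%N ->
    0 <= a -> a <= Num.min `|S / l%:R| ((S / l%:R) ^+ 2 / 2) ->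
  expR ((8 * K)^-1 * (l%:R * a)) <=
    mixture_term K l (Num.truncn (l%:R * a)) S.
Proof.
move=> K1 l0 a0; rewrite le_min => /andP[ax ax2].
have l0R : 0 < l%:R :> R by rewrite ltr0n.
set n := Num.truncn _; set c := (8 * K)^-1.
have c0 : 0 < c by rewrite invr_gt0; lra.
have la0 : 0 <= l%:R * a by rewrite mulr_ge0.
have [nla lan] : n%:R <= l%:R * a /\ l%:R * a < n.+1%:R.
  by have /andP[] := truncn_itv la0.
have na : n%:R / l%:R <= a by rewrite ler_pdivrMr// mulrC.
have := @tilt_gain R K (n%:R / l%:R) (S / l%:R) K1.
rewrite divr_ge0// => /(_ isT (le_trans na ax) (le_trans na ax2)).
rewrite /mixture_term /tilted_exp -/c; set t := tilt _ _ => gain.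
(* This is [tilt_gain] multiplied by [l], as [2 c = 1 / (4 K)]. *)
have gainS : 2 * c * n%:R <= t * `|S| - l%:R * K * t ^+ 2.
  have -> : 2 * c * n%:R = l%:R * (n%:R / l%:R / (4 * K)).
    by rewrite /c; field; rewrite !gt_eqF//; lra.
  have -> : t * `|S| - l%:R * K * t ^+ 2 =
      l%:R * (t * `|S / l%:R| - K * t ^+ 2).
    by rewrite normrM normfV (ger0_norm (ltW l0R)); field; rewrite gt_eqF.
  by rewrite ler_pM2l.
have tS : expR (2 * c * n%:R) <=
    expR (t * S - l%:R * K * t ^+ 2) + expR (- t * S - l%:R * K * (- t) ^+ 2).
  rewrite sqrrN; move: gainS; case: (ger0P S) => S0 gainS.
    by apply: le_trans (_ : _ <= expR (t * S - l%:R * K * t ^+ 2)) _;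
      rewrite ?ler_expR ?lerDl ?expR_ge0.
  rewrite mulrN -mulNr in gainS.
  by apply: le_trans (_ : _ <= expR (- t * S - l%:R * K * t ^+ 2)) _;
    rewrite ?ler_expR ?lerDr ?expR_ge0.
apply: le_trans (ler_wpM2l _ tS); last by rewrite mulr_ge0 ?exprn_ge0 ?expR_ge0.
rewrite -expRM_natl -!expRD ler_expR.
(* From [l a < n + 1] follows [c l a <= c - c n + 2 c n]. *)
move: lan; rewrite -natr1 => /ltW/(ler_wpM2l (ltW c0)); rewrite mulrDr mulr1; lra.
Qed.

Context {d} {T : measurableType d} (P : probability T R).
Variable X : nat -> {RV P >-> R}.

Lemma measurable_mixture_term K l n :
  measurable_fun setT (fun w => mixture_term K l n (\sum_(i < l) X i w)).
Proof.
have mS : measurable_fun setT (fun w => \sum_(i < l) X i w).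
  exact: measurable_sum.
apply: measurable_funM => //.
apply: measurable_funD; apply: measurableT_comp => //;
  by apply: measurable_funB => //; exact: measurable_funM.
Qed.

Hypothesis indX : mutually_independent P X.
Variable K : R.
Hypothesis K1 : 1 <= K.
Hypothesis XK : forall i t, `|t| <= 1 ->
  ('E_P[fun w => expR (t * X i w)] <= (expR (K * t ^+ 2))%:E)%E.

(** Both tilts have absolute value at most 1, so each exponential has expectation at most 1; hence
    the factor 2. *)
Lemma expectation_mixture_term_le l n :
  ('E_P[fun w => mixture_term K l n (\sum_(i < l) X i w)%R] <=
   (2 * expR (8 * K)^-1 * expR (- (8 * K)^-1) ^+ n)%:E)%E.
Proof.
have mS t : measurable_fun setT (fun w =>
    expR (t * (\sum_(i < l) X i w) - l%:R * K * t ^+ 2)).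
  apply: measurableT_comp => //.
  apply: measurable_funB => //; apply: measurable_funM => //.
  exact: measurable_sum.
rewrite unlock; under eq_integral do rewrite EFinM.
rewrite ge0_integralZl_EFin//; first last.
- by apply/measurable_EFinP/measurable_funD; exact: mS.
- by move=> w _; rewrite lee_fin addr_ge0 ?expR_ge0.
rewrite -mulrA [2 * _]mulrC [leRHS]EFinM lee_wpmul2l//.
under eq_integral do rewrite EFinD.
rewrite ge0_integralD//; [|exact/measurable_EFinP/mS..].
rewrite (_ : 2%:E = 1 + 1)%E; last by rewrite -EFinD.
have mgf_le1 t : `|t| <= 1 -> (\int[P]_w
    (expR (t * (\sum_(i < l) X i w) - l%:R * K * t ^+ 2))%:E <= 1)%E.
  move=> t1; have := mgf_sum_le_gauss P X l K t indX (fun i => XK i t t1).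
  by rewrite unlock.
by rewrite leeD// mgf_le1// ?normrN; exact: tilt_norm_le1.
Qed.

(** The dominating level depends on the sample point, so the whole series is used as a bound. Its
    expectation, taken termwise, is at most a geometric series of ratio [expR (- c)], free of
    [l]. *)
Lemma expectation_expR_min_le l : (0 < l)%N ->
  ('E_P[fun w => expR ((8 * K)^-1 * (l%:R *
       Num.min `|(\sum_(i < l) X i w) / l%:R|
         (((\sum_(i < l) X i w) / l%:R) ^+ 2 / 2)))%R] <=
   (2 * expR (8 * K)^-1 / (1 - expR (- (8 * K)^-1)))%:E)%E.
Proof.
move=> l0; set c := (8 * K)^-1.
have c0 : 0 < c by rewrite invr_gt0; move: K1; lra.
have mS : measurable_fun setT (fun w => (\sum_(i < l) X i w) / l%:R).
  by apply: measurable_funM => //; exact: measurable_sum.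
apply: (@le_trans _ _ (\sum_(n <oo)
    'E_P[fun w => mixture_term K l n (\sum_(i < l) X i w)%R])%E); last first.
  apply: lime_le.
    apply: is_cvg_nneseries => n _ _; apply: expectation_ge0 => w.
    exact: mixture_term_ge0.
  apply: nearW => N.
  apply: (@le_trans _ _ (series (geometric (2 * expR c) (expR (- c))) N)%:E).
    rewrite /series/= -sumEFin; apply: lee_sum => n _.
    exact: expectation_mixture_term_le.
  rewrite lee_fin geometric_le_lim// ?expR_gt0 ?mulr_ge0 ?expR_ge0//.
  by rewrite ger0_norm ?expR_ge0// expR_lt1 oppr_lt0.
rewrite unlock -integral_nneseries//; last 2 first.
- by move=> n; exact/measurable_EFinP/measurable_mixture_term.
- by move=> n w _; rewrite lee_fin mixture_term_ge0.
apply: ge0_le_integral => //.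
- apply/measurable_EFinP/measurableT_comp => //; do 2 apply: measurable_funM => //.
  apply: measurable_minr; first exact: measurableT_comp.
  by apply: measurable_funM => //; exact: measurable_funX.
- apply: ge0_emeasurable_sum => n *; first by rewrite lee_fin mixture_term_ge0.
  exact/measurable_EFinP/measurable_mixture_term.
- move=> w _; set S := \sum_(i < l) X i w; set a := Num.min _ _.
  have a0 : 0 <= a by rewrite le_min normr_ge0 divr_ge0 ?sqr_ge0.
  (* The successor makes the dominating term the last one of the partial sum. *)
  apply: le_trans (nneseries_lim_ge (Num.truncn (l%:R * a)).+1 _); last first.
    by move=> n _ _; rewrite lee_fin mixture_term_ge0.
  rewrite big_nat_recr//= -[leLHS]add0e leeD//.
    by apply: sume_ge0 => n _; rewrite lee_fin mixture_term_ge0.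
  by rewrite lee_fin; apply: expR_le_mixture_term.
Qed.

End cramer.

(** * Choice of constants and passage from the minimum to [G] *)

Theorem lemma2 (R : realType) (d : measure_display) (T : measurableType d)
    (P : probability T R) (zeta : nat -> {RV P >-> R})
    (zeta_iid : iid P zeta)
    (zeta_mean0 : forall i, ('E_P[zeta i] = 0)%E)
    (Lambda_fin : forall (i : nat) (lambda : R),
       (log_mgf P (zeta i) lambda < +oo)%E)
    (G : R -> R) (G_smooth : smooth G) (G_ge0 : forall x, 0 <= G x)
    (C1 : R) (G_le : forall x, G x <= C1 * Num.min `|x| (x ^+ 2 / 2)) :
  exists gamma0 C : R, 0 < gamma0 /\
    forall (gamma : R) (l : nat),
      0 < gamma -> gamma < gamma0 -> gamma0^-1 <= l%:R ->
      ('E_P[fun w => expR (gamma * l%:R *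
               G ((\sum_(i < l) zeta i w) / l%:R))%R] < C%:E)%E.
Proof.
have [indep ident] := zeta_iid.
have mgf_fin i t := log_mgf_lty _ _ _ (Lambda_fin i t).
have mgf_ge0 i t : (0 <= 'E_P[fun w => expR (t * zeta i w)%R])%E.
  by apply: expectation_ge0 => w; exact: expR_ge0.
pose m t := fine ('E_P[fun w => expR (t * zeta 0%N w)%R])%E.
have mE i t : ('E_P[fun w => expR (t * zeta i w)%R] = (m t)%:E)%E.
  by rewrite (expectation_expRZ_eq _ _ i 0%N)// fineK// ge0_fin_numE.
have m0 t : 0 <= m t by rewrite fine_ge0.
(* [mgf_le_gauss] asks for [4 * M]; the added 1 secures [1 <= K] for the tilt. *)
pose M := m 2 + m (- 2); pose K := 4 * M + 1.
have M0 : 0 <= M by rewrite addr_ge0.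
have K1 : 1 <= K by rewrite /K; lra.
have zetaK i t : `|t| <= 1 ->
    ('E_P[fun w => expR (t * zeta i w)%R] <= (expR (K * t ^+ 2))%:E)%E.
  move=> t1; apply: (@le_trans _ _ (expR (4 * M * t ^+ 2))%:E).
    by apply: mgf_le_gauss => //; rewrite !mE -EFinD.
  by rewrite lee_fin ler_expR ler_wpM2r ?sqr_ge0// /K; lra.
(* At [x = 1] the minimum is [1 / 2], so [G 1 >= 0] fixes the sign. *)
have C10 : 0 <= C1.
  have /(le_trans (G_ge0 1)) := G_le 1.
  by rewrite pmulr_lge0// lt_min normr1 ltr01/= expr1n; lra.
have c0 : 0 < (8 * K)^-1 by rewrite invr_gt0; lra.
have mG : measurable_fun setT G.
  apply: measurable_realfun.continuous_measurable_fun => x.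
  exact/differentiable_continuous/derivable1_diffP/(G_smooth 0%N x).
(* The denominator stays positive even for [C1 = 0], and [gamma * C1] stays below [(8 * K)^-1]. *)
exists ((8 * K)^-1 / (C1 + 1)).
(* The final 1 makes the inequality strict. *)
exists (2 * expR (8 * K)^-1 / (1 - expR (- (8 * K)^-1)) + 1).
have gamma00 : 0 < (8 * K)^-1 / (C1 + 1) by rewrite divr_gt0//; lra.
split=> // gamma l gamma0; rewrite ltr_pdivlMr; last by lra.
move=> gammaC1 lgamma0.
have l0R : 0 < l%:R :> R by apply: lt_le_trans lgamma0; rewrite invr_gt0.
have l0 : (0 < l)%N by rewrite -(ltr0n R).
have mS : measurable_fun setT (fun w => (\sum_(i < l) zeta i w) / l%:R).
  by apply: measurable_funM => //; exact: measurable_sum.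
apply: (@le_lt_trans _ _ (2 * expR (8 * K)^-1 / (1 - expR (- (8 * K)^-1)))%:E);
  last by rewrite lte_fin ltrDl.
apply: le_trans (expectation_expR_min_le P zeta indep K K1 zetaK l l0).
rewrite unlock; apply: ge0_le_integral => //.
- apply/measurable_EFinP/measurableT_comp => //; apply: measurable_funM => //.
  exact: measurableT_comp.
- apply/measurable_EFinP/measurableT_comp => //; do 2 apply: measurable_funM => //.
  apply: measurable_minr; first exact: measurableT_comp.
  by apply: measurable_funM => //; exact: measurable_funX.
- move=> w _; rewrite lee_fin ler_expR.
  have := G_le ((\sum_(i < l) zeta i w) / l%:R).
  set a := Num.min _ _; set g := G _ => ga.
  have a0 : 0 <= a by rewrite le_min normr_ge0 divr_ge0 ?sqr_ge0.
  rewrite [gamma * _]mulrC -mulrA [leRHS]mulrCA ler_pM2l//.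
  apply: le_trans (ler_wpM2l (ltW gamma0) ga) _.
  by rewrite mulrA ler_wpM2r//; nra.
Qed.
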